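(* Let $p_1,\dots,p_k$ be distinct primes ($k\ge 1$), and let $G=S_{p_1}\times\cdots\times S_{p_k}$ where $S_{p_i}=\mathbb{Z}_{p_i^{e_i}}\times\mathbb{Z}_{p_i^{t_i}}$ with $1\le t_i\le e_i$ for each $1\le i\le k$. Let $x=(a_1,a_2,\ldots,a_k)$ and $y=(b_1,b_2,\ldots,b_k)$ be elements of $G$, with $a_i,b_i\in S_{p_i}$. Then $\langle x,y\rangle=G$ if and only if $\langle a_i,b_i\rangle=S_{p_i}$ for all $1\le i\le k$.
   Context: Groups are finite abelian groups under componentwise addition; $\mathbb{Z}_n$ is the cyclic group of integers modulo $n$; $\langle x,y\rangle$ is the subgroup generated by $x$ and $y$. *)

(* Defs.v *)
From mathcomp Require Import all_boot all_fingroup all_algebra.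
Set Implicit Arguments.
Unset Strict Implicit.
Unset Printing Implicit Defensive.

(* Finite groups are written multiplicatively in MathComp: the law [mulg] of
   'Z_n is addition modulo n, and those of pairs and of dependent finite
   functions are componentwise.  'Z_n has max(n, 2) elements, so it is the
   cyclic group of order n exactly when 1 < n; this holds for n = p ^ e and
   n = p ^ t when p is prime and e, t >= 1. *)

Definition rank2_group (p e t : nat) : finGroupType :=
  ('Z_(p ^ e) * 'Z_(p ^ t))%type.

Definition rank2_product (k : nat) (p e t : 'I_k -> nat) : finGroupType :=
  {dffun forall i : 'I_k, rank2_group (p i) (e i) (t i)}.

(* Main.v *)
Require Import Defs.
From mathcomp Require Import all_boot all_fingroup all_algebra.

Local Open Scope group_scope.

(** Projection to coordinate [i] is a surjective morphism carrying the subgroup generated by [x],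
    [y] onto the one generated by [x i], [y i] ([morphim_dffun_gen2]), so generation passes to each
    factor. The converse is a count ([group_dffun_full]): the factors have orders that are powers of
    distinct primes, and each order divides that of the subgroup, hence so does their product, the
    order of the whole group. *)

Lemma dvdn_prod_coprime (I : eqType) (r : seq I) (F : I -> nat) (n : nat) :
    uniq r -> (forall i j, i != j -> coprime (F i) (F j)) ->
    (forall i, F i %| n)%N ->
  (\prod_(i <- r) F i %| n)%N.
Proof.
move=> uniq_r coF dvdF; elim: r uniq_r => [|a r IHr] /=.
  by rewrite big_nil dvd1n.
case/andP=> a_notin_r /IHr dvd_r; rewrite big_cons Gauss_dvd ?dvdF //.
(* It remains that [F a] is coprime to the tail product, shown factor by factor; [big_seq] keeps
   [i \in r], which forces [i != a]. *)
rewrite big_seq; elim/big_rec: _ => [|i m r_i co_am]; first exact: coprimen1.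
by rewrite coprimeMr co_am coF //; apply: contraNneq a_notin_r => ->.
Qed.

Lemma dvdn_card_dffun (I : finType) (gT : I -> finType) (n : nat) :
    (forall i j, i != j -> coprime #|gT i| #|gT j|) ->
    (forall i, #|gT i| %| n)%N ->
  (#|{dffun forall i, gT i}| %| n)%N.
Proof.
move=> co_gT dvd_n; rewrite card_dep_ffun foldrE big_map.
exact: dvdn_prod_coprime (enum_uniq I) co_gT dvd_n.
Qed.

(* Orders decide: every [gT i] is a quotient of [H], so [#|gT i|] divides
   [#|H|]; by coprimality so does their product. *)
Lemma group_dffun_full (I : finType) (gT : I -> finGroupType)
    (H : {group {dffun forall i, gT i}}) :
    (forall i j, i != j -> coprime #|gT i| #|gT j|) ->
    (forall i, dffun_morphism gT i @* H = [set: gT i]) ->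
  H :=: [set: {dffun forall i, gT i}].
Proof.
move=> co_gT projH; apply/eqP; rewrite eqEcard subsetT cardsT dvdn_leq //.
by apply: dvdn_card_dffun => // i; rewrite -cardsT -projH dvdn_morphim.
Qed.

Lemma morphim_dffun_gen2 (I : finType) (gT : I -> finGroupType)
    (x y : {dffun forall i, gT i}) (i : I) :
  dffun_morphism gT i @* <<[set x; y]>> = <<[set x i; y i]>>.
Proof.
by rewrite morphim_gen ?subsetT // morphimU !morphim_set1 ?inE.
Qed.

Lemma card_rank2_group (p e t : nat) :
  prime p -> (0 < e)%N -> (0 < t)%N -> #|rank2_group p e t| = (p ^ (e + t))%N.
Proof.
move=> p_pr e_gt0 t_gt0; have p_gt1 := prime_gt1 p_pr.
(* [Zp_cast] requires a modulus above 1: read 1 as [p ^ 0] and compare exponents. *)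
by rewrite card_prod !card_ord expnD !Zp_cast // -(expn0 p) ltn_exp2l.
Qed.

Theorem theorem3p5 (k : nat) (p e t : 'I_k -> nat)
    (k_gt0 : (0 < k)%N)
    (p_prime : forall i, prime (p i))
    (p_inj : injective p)
    (t_bounds : forall i, (1 <= t i <= e i)%N)
    (x y : rank2_product p e t) :
  <<[set x; y]>> = [set: rank2_product p e t] <->
  (forall i : 'I_k,
     <<[set x i; y i]>> = [set: rank2_group (p i) (e i) (t i)]).
Proof.
have t_gt0 i : (0 < t i)%N by case/andP: (t_bounds i).
have e_gt0 i : (0 < e i)%N.
  by case/andP: (t_bounds i); apply: leq_trans.
split=> [gen_xy i | gen_xyi].
  rewrite -morphim_dffun_gen2 gen_xy; apply/setP=> z; rewrite [RHS]inE.
  (* Surjectivity of the projection: the preimage is [z] at [i] and the identity elsewhere. *)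
  apply/morphimP; exists (dfung1 z); rewrite ?inE //=.
  by rewrite dfung1_id.
apply: (@group_dffun_full _ _ <<[set x; y]>>%G) => [i j ne_ij | i].
  (* Coprimality of the orders reduces to that of the primes [p i] and [p j], distinct by
     injectivity. *)
  rewrite !card_rank2_group //; rewrite coprimeXl // coprimeXr //.
  by rewrite prime_coprime // dvdn_prime2 // (inj_eq p_inj).
by rewrite morphim_dffun_gen2 gen_xyi.
Qed.
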